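(* Let $X$ be a Calabi-Yau threefold with Gopakumar-Vafa invariants $[\mathrm{GV}]_{\beta,g}$ and sheaf invariants $\Omega_{\beta,n}$ (see context). The asymptotic series giving the non-constant part of the generating function of Gromov-Witten invariants, $$F_{GW}(\lambda,t)=\frac1{\lambda^2}\tilde F^0(t)+\tilde F^1(t)+\sum_{g=2}^\infty\lambda^{2g-2}\tilde F^g(t),$$ can be written in terms of the sheaf invariants as $$\tilde F^0(t)=\sum_{\beta>0}\sum_{n\in\mathbb Z}\Omega_{\beta,n}\sum_{k\ge1}\frac{Q^{k\beta}}{k^3},$$ $$\tilde F^1(t)=\sum_{\beta>0}\sum_{n\in\mathbb Z}\Omega_{\beta,n}\,\frac12\bigl(2n\,B_1(n)-B_2(n)\bigr)\mathrm{Li}_1(Q^\beta),$$ and for $g\ge2$ $$\tilde F^g(t)=\sum_{\beta>0}\sum_{n\in\mathbb Z}\frac{(-1)^{g-1}\Omega_{\beta,n}}{2\,(2g)!}\Bigl((2g-1)\bigl(B_{2g}(n)+B_{2g}(-n)\bigr)-2g\,n\bigl(B_{2g-1}(n)-B_{2g-1}(-n)\bigr)\Bigr)\mathrm{Li}_{3-2g}(Q^\beta).$$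
   Context: $\beta>0$ ranges over non-constant curve classes in $H_2(X,\mathbb Z)$; $Q^\beta=e^{2\pi i t^\beta}$ are formal variables with $Q^{k\beta}=(Q^\beta)^k$. $\mathrm{Li}_s(z)=\sum_{k\ge1}z^k/k^s$. $B_m(x)$ are the Bernoulli polynomials: $\frac{we^{wx}}{e^w-1}=\sum_{m\ge0}B_m(x)\frac{w^m}{m!}$. $\tilde F^g(t)=\sum_{\beta>0}[\mathrm{GW}]_{\beta,g}Q^\beta$ is the genus $g$ generating function of non-constant Gromov-Witten invariants of $X$. The Gopakumar-Vafa invariants $[\mathrm{GV}]_{\beta,g}\in\mathbb Z$ are such that $\sum_{g\ge0}\lambda^{2g-2}\tilde F^g(t)$ is the asymptotic expansion at $\lambda=0$ of $$F_{GV}(\lambda,t)=\sum_{\beta>0}\sum_{g\ge0}[\mathrm{GV}]_{\beta,g}\sum_{k\ge1}\frac1k\left(2\sin\frac{k\lambda}2\right)^{2g-2}Q^{k\beta}.$$ Standing assumption: for each $\beta$, $[\mathrm{GV}]_{\beta,g}=0$ for all sufficiently large $g$. The sheaf invariants are defined by $$\sum_{n\in\mathbb Z}\Omega_{\beta,n}y^n=\sum_{g\ge0}[\mathrm{GV}]_{\beta,g}(-1)^g(y^{1/2}-y^{-1/2})^{2g},$$ so only finitely many $\Omega_{\beta,n}$ are non-zero for each $\beta$.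
   Formalization: The genus-one formula is proved with the opposite overall sign, −½(2nB_1(n) − B_2(n)): as printed it is false, e.g. for the resolved conifold (Ω=1 at n=0) F~^1 = Li_1(Q)/12 but the printed formula gives −Li_1(Q)/12. *)

(* Defs.v *)
From HB Require Import structures.
From mathcomp Require Import all_boot all_order all_algebra.
From mathcomp Require Import all_classical all_reals all_analysis.
Set Implicit Arguments.
Unset Strict Implicit.
Unset Printing Implicit Defensive.
Import Order.TTheory GRing.Theory Num.Theory.
Import numFieldNormedType.Exports.
Local Open Scope classical_set_scope.
Local Open Scope ring_scope.

(* [H2] stands for H_2(X, Z) and [curve : set H2] for the classes beta > 0 of
   non-constant curves.  A formal series in the variables Q^beta with
   coefficients in K is a function H2 -> K giving the coefficient of each
   Q^gamma; infinite sums of series are taken coefficientwise.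

   Pitfall: [\sum_(i \in A)] is a finite-support sum, equal to 0 when the
   support is infinite.  The hypotheses [finitely_divisible],
   [eventually_zero_GV] and [sheaf_invariants] make every sum below one of
   finite support. *)

Definition posnat : set nat := [set k | (0 < k)%N].

(* Q^beta *)
Definition Qmon (K : nzRingType) (H2 : zmodType) (beta : H2) : H2 -> K :=
  fun gamma => (beta == gamma)%:R.

(* Each Q^gamma occurs in only finitely many of the monomials (Q^beta)^k.  This
   holds for curve classes because H_2(X, Z) is finitely generated and a class
   of positive degree is not torsion; in particular 0 is not in [curve]. *)
Definition finitely_divisible (H2 : zmodType) (curve : set H2) : Prop :=
  forall gamma : H2,
    finite_set [set kb : nat * H2 |
                 [/\ posnat kb.1, curve kb.2 & kb.2 *+ kb.1 = gamma]].

(* Li_s(Q^beta), with (Q^beta)^k = Q^(k beta) *)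
Definition polylogQ (K : fieldType) (H2 : zmodType) (s : int) (beta : H2) :
    H2 -> K :=
  fun gamma => \sum_(k \in posnat) Qmon K (beta *+ k) gamma / k%:R ^ s.

(* \tilde F^g *)
Definition Ftilde (H2 : zmodType) (curve : set H2) (GW : H2 -> nat -> rat)
    (g : nat) : H2 -> rat :=
  fun gamma => \sum_(beta \in curve) GW beta g * Qmon rat beta gamma.

Definition F_GV (R : realType) (H2 : zmodType) (curve : set H2)
    (GV : H2 -> nat -> int) (lambda : R) : H2 -> R :=
  fun gamma =>
    \sum_(beta \in curve) \sum_(g \in [set: nat])
      (GV beta g)%:~R *
      \sum_(k \in posnat)
        k%:R^-1 * (2 * sin (k%:R * lambda / 2)) ^ (2 * g%:Z - 2)
        * Qmon R (beta *+ k) gamma.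

(* sum_(g >= 0) a_g lambda^(2g-2) is the asymptotic expansion of f at 0 *)
Definition asymptotic_expansion (R : realType) (f : R -> R) (a : nat -> R) :
    Prop :=
  forall N : nat,
    (fun lambda : R =>
       (f lambda - \sum_(g < N.+1) lambda ^ (2 * g%:Z - 2) * a g)
       / lambda ^ (2 * N%:Z - 2)) @ (0 : R)^' --> (0 : R).

Definition eventually_zero_GV (H2 : zmodType) (curve : set H2)
    (GV : H2 -> nat -> int) : Prop :=
  forall beta, curve beta -> \forall g \near \oo, GV beta g = 0.

Definition GV_invariants (R : realType) (H2 : zmodType) (curve : set H2)
    (GW : H2 -> nat -> rat) (GV : H2 -> nat -> int) : Prop :=
  forall gamma : H2,
    asymptotic_expansion (fun lambda : R => F_GV curve GV lambda gamma)
      (fun g => ratr (Ftilde curve GW g gamma)).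

(* The defining identity of the sheaf invariants is one of Laurent polynomials
   in y^(1/2), read in the field of rational functions in y^(1/2) = 'X. *)
Definition sqrty : {fraction {poly int}} := tofrac 'X.

Definition sheaf_invariants (H2 : zmodType) (curve : set H2)
    (GV : H2 -> nat -> int) (Omega : H2 -> int -> int) : Prop :=
  forall beta, curve beta ->
    finite_set [set n | Omega beta n != 0] /\
    \sum_(n \in [set: int]) (Omega beta n)%:~R * (sqrty ^+ 2) ^ n =
    \sum_(g \in [set: nat])
      (GV beta g)%:~R * (-1) ^+ g * (sqrty - sqrty^-1) ^+ (2 * g).

(* Product of formal power series given by their coefficients *)
Definition cauchy_prod (K : nzRingType) (a b : nat -> K) : nat -> K :=
  fun n => \sum_(i < n.+1) a i * b (n - i)%N.

(* (e^w - 1) * sum_m B_m(x) w^m / m! = w e^(w x) in Q[x][[w]] *)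
Definition bernoulli_polynomials (B : nat -> {poly rat}) : Prop :=
  cauchy_prod
    (fun j => if j is 0%N then 0 else (j`!%:R^-1)%:P)
    (fun m => m`!%:R^-1 *: B m)
  =1 (fun j => if j is i.+1 then i`!%:R^-1 *: 'X^i else 0).

(* Main.v *)
Require Import Defs.
From HB Require Import structures.
From mathcomp Require Import all_boot all_order all_algebra.
From mathcomp Require Import all_classical all_reals all_analysis.
From mathcomp Require Import finmap complex ring lra zify.
Import Order.TTheory GRing.Theory Num.Theory.
Import numFieldNormedType.Exports.
Set Implicit Arguments.
Unset Strict Implicit.
Unset Printing Implicit Defensive.
Local Open Scope classical_set_scope.
Local Open Scope ring_scope.

(** At [y = e ^ (i x)] the defining identity of the sheaf invariants reads
    [sum_n Omega_n cos (n x) = sum_g GV_g (2 sin (x / 2)) ^ (2 g)], so that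
    [F_GV] is a sum over [beta] and [k] of
    [k^-1 Omega_n cos (n k lambda) / (2 sin (k lambda / 2)) ^ 2].
    With [w = i x],
    [e ^ (n w) / (2 sin (x / 2)) ^ 2 = - e ^ ((n + 1) w) / (e ^ w - 1) ^ 2
     = d/dw (e ^ (n w) / (e ^ w - 1)) - n e ^ (n w) / (e ^ w - 1)],
    whose Laurent coefficients are combinations of [B_m (n)] and [B_(m-1) (n)].
    Only the Taylor expansion of [cos] is needed analytically: the quotient is
    replaced by the convolution recurrence obtained by multiplying by
    [(2 sin (x / 2)) ^ 2 = 2 - 2 cos x], which determines its coefficients.
    Uniqueness of asymptotic expansions concludes. *)

(** * Power series truncated modulo ['X ^ N], and auxiliary finite sums *)

Lemma dvdXnP (F : fieldType) (N : nat) (p : {poly F}) :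
  reflect (forall i, (i < N)%N -> p`_i = 0) ('X^N %| p).
Proof.
apply: (iffP idP) => [/dvdpP [q ->] i iN|p0]; first by rewrite coefMXn iN.
rewrite -[p](poly_take_drop N) (_ : take_poly N p = 0) ?add0r ?dvdp_mull//.
by apply/polyP => i; rewrite coef_take_poly coef0; case: ifP => // /p0.
Qed.

(** Differentiation loses one order of vanishing; the factor ['X] restores it, so identities may be
    differentiated at fixed precision [N]. *)
Lemma dvdXn_deriv (F : fieldType) (N : nat) (p : {poly F}) :
  'X^N %| p -> 'X^N %| 'X * p^`().
Proof.
move=> /dvdXnP p0; apply/dvdXnP => -[|i] iN; rewrite coefXM//= coef_deriv.
by rewrite p0// mul0rn.
Qed.

Lemma sum_even (V : nmodType) (f : nat -> V) (m : nat) :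
  (forall i, odd i -> f i = 0) ->
  \sum_(i < (2 * m).+1) f i = \sum_(k < m.+1) f (2 * k)%N.
Proof.
move=> f0; elim: m => [|m IH]; first by rewrite !big_ord_recl !big_ord0.
rewrite (_ : (2 * m.+1)%N = (2 * m).+2); last by lia.
rewrite 2!big_ord_recr/= IH [RHS]big_ord_recr/= f0 ?addr0; last by lia.
by congr (_ + f _); lia.
Qed.

(** This is the degree [n] coefficient of [e ^ (- w) * e ^ w = 1]: after multiplication by [n!] it
    is the binomial expansion of [(1 - 1) ^ n]. *)
Lemma exp_mul_expN_coef (F : numFieldType) (n : nat) : (0 < n)%N ->
  \sum_(i < n.+1) ((-1) ^+ i / i`!%:R) * (n - i)`!%:R^-1 = 0 :> F.
Proof.
move=> n0; apply: (mulfI (x := n`!%:R)).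
  by rewrite pnatr_eq0 -lt0n fact_gt0.
rewrite mulr0 mulr_sumr.
have := exprDn (1 : F) (-1) n; rewrite subrr expr0n gtn_eqF// => h.
rewrite [RHS]h.
apply: eq_bigr => -[i /=]; rewrite ltnS => iN _.
rewrite expr1n mul1r -mulr_natr -(bin_fact iN) !natrM.
have a0 : i`!%:R != 0 :> F by rewrite pnatr_eq0 -lt0n fact_gt0.
have b0 : (n - i)`!%:R != 0 :> F by rewrite pnatr_eq0 -lt0n fact_gt0.
by field; rewrite a0 b0.
Qed.

(** * Laurent coefficients through Bernoulli polynomials *)

Section Bernoulli.
Context (B : nat -> {poly rat}) (B_gen : bernoulli_polynomials B) (x : rat).

Let b m : rat := m`!%:R^-1 * (B m).[x].
Let e j : rat := if j is 0%N then 0 else j`!%:R^-1.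

Let conv_eb k :
  \sum_(i < k.+1) e i * b (k - i)%N =
  if k is i.+1 then i`!%:R^-1 * x ^+ i else 0.
Proof.
have := congr1 (horner^~ x) (B_gen k); rewrite /cauchy_prod horner_sum => eq.
transitivity (if k is i.+1 then (i`!%:R^-1 *: 'X^i).[x] else 0); last first.
  by case: (k) => // i; rewrite hornerZ hornerXn.
transitivity (if k is i.+1 then (i`!%:R^-1 *: 'X^i) else 0 : {poly rat}).[x].
  rewrite -eq; apply: eq_bigr => i _; rewrite hornerM hornerZ /e.
  by case: (nat_of_ord i) => [|j]; rewrite ?horner0 ?hornerC.
by case: (k); rewrite ?horner0.
Qed.

(* Modulo ['X ^ N], [1 + E] is [e ^ w], [Em] is [e ^ (- w)] and [G] is
   [e ^ (x w)]. Differentiating [E * b = w * G] gives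
   [E * D = - w * (1 + E) * b]; multiply by [E * Em]. *)
Lemma bernoulli_square N (D E Em G : {poly rat}) :
  D = 'X * (\poly_(i < N) b i)^`() - \poly_(i < N) b i
      - x%:P * 'X * \poly_(i < N) b i ->
  E = \poly_(i < N) e i ->
  Em = \poly_(i < N) ((-1) ^+ i / i`!%:R) ->
  G = \poly_(i < N) (i`!%:R^-1 * x ^+ i) ->
  'X^N %| (E - 1 + Em) * D + 'X ^+ 2 * G.
Proof.
move=> DE EE EmE GE; set b_ := \poly_(i < N) b i in DE.
(* [t1] to [t4] are the truncation errors of [(e ^ w - 1) * b = w * e ^ (x w)],
   [(e ^ w - 1)' = e ^ w], [(e ^ (x w))' = x * e ^ (x w)] and [e ^ (- w) * e ^ w = 1]; the two
   differential equations are multiplied by [w]. *)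
pose t1 := E * b_ - 'X * G.
pose t2 := 'X * E^`() - 'X * (1 + E).
pose t3 := 'X * G^`() - x%:P * 'X * G.
pose t4 := Em * (1 + E) - 1.
have d1 : 'X^N %| t1.
  apply/dvdXnP => i iN; rewrite coefB coefM coefXM.
  rewrite (eq_bigr (fun j : 'I_i.+1 => e j * b (i - j)%N)); last first.
    move=> j _; rewrite EE !coef_poly (leq_ltn_trans (leq_subr _ _) iN).
    by rewrite (leq_trans (ltn_ord j)).
  rewrite conv_eb GE; case: i iN => [|i] iN /=; first by rewrite subrr.
  by rewrite coef_poly (ltnW iN) subrr.
have d1' := dvdXn_deriv d1.
have d2 : 'X^N %| t2.
  apply/dvdXnP => -[|i] iN; rewrite coefB !coefXM/= ?subrr//.
  rewrite EE coef_deriv coefD coef1 !coef_poly iN (ltnW iN) /=.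
  rewrite (_ : _ + e i = i`!%:R^-1) => [|]; last first.
    by case: (i) => [|j]; rewrite ?addr0 ?add0r ?invr1.
  rewrite -mulr_natr factS natrM; field.
  by rewrite nat1r !pnatr_eq0 -lt0n fact_gt0.
have d3 : 'X^N %| t3.
  apply/dvdXnP => i iN; rewrite coefB -mulrA coefCM !coefXM GE.
  case: i iN => [|i] iN /=; first by rewrite mulr0 subrr.
  rewrite coef_deriv !coef_poly iN (ltnW iN).
  rewrite -mulr_natr factS natrM exprS; field.
  by rewrite nat1r !pnatr_eq0 -lt0n fact_gt0.
have d4 : 'X^N %| t4.
  apply/dvdXnP => i iN; rewrite coefB coefM coef1.
  rewrite (eq_bigr (fun j : 'I_i.+1 => (-1) ^+ j / j`!%:R * (i - j)`!%:R^-1)).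
    case: i iN => [|i] iN; last by rewrite exp_mul_expN_coef ?subrr.
    by rewrite big_ord1 /= fact0 expr0 divr1 mulr1 subrr.
  move=> j _; rewrite EE EmE coefD coef1 !coef_poly (leq_ltn_trans (leq_subr _ _) iN).
  rewrite (leq_trans (ltn_ord j)) //.
  by case: (i - j)%N => [|k] /=; rewrite ?addr0 ?add0r ?invr1.
(* All terms in [G] and in the derivative of [E] cancel here, leaving
   [u = E * D + 'X * (1 + E) * b_]. *)
pose u := 'X * t1^`() - t2 * b_ + 'X * t3 - t1 - x%:P * 'X * t1.
have du : 'X^N %| u 
  by apply: dvdp_sub (dvdp_mull _ d1); apply: dvdp_sub d1;
    apply: dvdp_add (dvdp_mull _ d3); apply: dvdp_sub d1' (dvdp_mulr _ d2).
rewrite (_ : _ + _ = Em * E * u - t4 * ('X * E * b_) - 'X * t1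
             - t4 * ((E - 1) * D)).
  apply: dvdp_sub (dvdp_mulr _ d4); apply: dvdp_sub (dvdp_mull _ d1).
  exact: dvdp_sub (dvdp_mull _ du) (dvdp_mulr _ d4).
rewrite /u /t1 /t2 /t3 /t4 !(derivB, derivM, derivX) DE.
by ring.
Qed.

(* The coefficient of [t ^ (2 g - 2)] in [cos (x t) / (2 sin (t / 2)) ^ 2]. *)
Definition csc2_coef (g : nat) : rat :=
  (-1) ^+ g.+1 / (2 * g)`!%:R *
  ((2 * g)%:R * (B (2 * g)%N).[x] - (B (2 * g)%N).[x]
   - (2 * g)%:R * x * (B (2 * g - 1)%N).[x]).

(** Reads off degree [2 m + 2] in [bernoulli_square]. With [w = i t] this is the degree [2 m]
    coefficient of [(2 - 2 cos t) * (cos (x t) / (2 sin (t / 2)) ^ 2) = cos (x t)], the signs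
    [(-1) ^ g] absorbing the powers of [i]. *)
Lemma csc2_coef_conv m :
  \sum_(g < m.+1) csc2_coef g * ((-1) ^+ (m - g) * 2 / (2 * (m - g)).+2`!%:R) =
  (-1) ^+ m * x ^+ (2 * m) / (2 * m)`!%:R.
Proof.
have /dvdXnP := bernoulli_square (N := (2 * m.+1).+1) (erefl _) (erefl _) (erefl _) (erefl _).
set b_ := \poly_(i < _) b i.
move=> /(_ (2 * m.+1)%N (leqnn _)).
rewrite coefD coefXnM coef_poly ltnNge (_ : (2 <= 2 * m.+1)%N) /=; last by lia.
have m2 : (2 * m.+1 - 2 = 2 * m)%N by rewrite mulnS addKn.
have m2' : (2 * m < (2 * m.+1).+1)%N by rewrite mulnS ltnS leq_addl.
rewrite m2 m2'.
rewrite mulrC coefM.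
(* [s] lists the coefficients of [e ^ w + e ^ (- w) - 2] and [d] those of [D]. Since [s] vanishes at
   odd indices and at 0, only the even [i] below [2 m + 2] contribute. *)
pose s j : rat := if j is 0%N then 0 else (1 + (-1) ^+ j) / j`!%:R.
pose d j : rat := j%:R * b j - b j - (if j is i.+1 then x * b i else 0).
rewrite (eq_bigr (fun i : 'I_(2 * m.+1).+1 => d i * s (2 * m.+1 - i)%N)); last first.
  move=> i _; rewrite !(coefB, coefD) -mulrA coefCM !coefXM coef1 coef_deriv !coef_poly.
  rewrite (leq_ltn_trans (leq_subr _ _)) // /s /d ltn_ord.
  congr (_ * _).
    case: i => -[|i] /= iN; first by rewrite mul0r mulr0.
    by rewrite iN (ltnW iN) -[b _ *+ _]mulr_natl.
  case: (_ - i)%N => [|k] /=; first by rewrite fact0 expr0 divr1 add0r addNr.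
  by rewrite subr0 mulrDl mul1r.
rewrite (sum_even (f := fun i => d i * s (2 * m.+1 - i)%N)); last first.
  move=> i io; rewrite /s; have [|im] := leqP (2 * m.+1) i.
    by rewrite -subn_eq0 => /eqP ->; rewrite mulr0.
  rewrite (_ : (2 * m.+1 - i)%N = (2 * (m - i./2)).+1); last by lia.
  by rewrite exprS exprM sqrrN !expr1n mulr1 subrr mul0r mulr0.
rewrite big_ord_recr /= subnn mulr0 addr0 => /eqP; rewrite addr_eq0 => /eqP ds.
transitivity ((-1) ^+ m.+1 * \sum_(k < m.+1) d (2 * k)%N * s (2 * m.+1 - 2 * k)%N);
  last by rewrite ds exprS; ring.
rewrite mulr_sumr; apply: eq_bigr => -[g /=]; rewrite ltnS => gm _.
rewrite (_ : (2 * m.+1 - 2 * g = (2 * (m - g)).+2)%N); last by lia.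
have -> : (-1) ^+ m.+1 = (-1) ^+ g.+1 * (-1) ^+ (m - g) :> rat.
  by rewrite -exprD addSn subnKC.
have -> : s (2 * (m - g)).+2 = 2 / (2 * (m - g)).+2`!%:R.
  by rewrite /s -addn2 exprD exprM !sqrrN !expr1n mulr1.
have -> : d (2 * g)%N = ((2 * g)%:R * (B (2 * g)%N).[x] - (B (2 * g)%N).[x]
    - (2 * g)%:R * x * (B (2 * g - 1)%N).[x]) / (2 * g)`!%:R.
  rewrite /d /b; case: (g) => [|i]; first by rewrite !mul0r subr0; ring.
  rewrite mulnS subn1 /= -/(2 * i)%N (factS (2 * i).+1) natrM.
  by field; rewrite -natrM -natrD !pnatr_eq0 -lt0n fact_gt0.
by rewrite /csc2_coef; ring.
Qed.

End Bernoulli.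

(** Evenness of [cos]: the recurrence determines the coefficients one after the other, and its
    right-hand side depends on [x] only through [x ^ (2 m)]. *)
Lemma csc2_coefN (B : nat -> {poly rat}) (B_gen : bernoulli_polynomials B)
    (x : rat) (g : nat) :
  csc2_coef B (- x) g = csc2_coef B x g.
Proof.
have [m] := ubnP g; elim: m g => // m IH g gm.
have := csc2_coef_conv B_gen (- x) g.
rewrite [(- x) ^+ _]exprM sqrrN -exprM -(csc2_coef_conv B_gen x g).
rewrite !big_ord_recr /= subnn muln0 expr0 mul1r divff // !mulr1.
rewrite (eq_bigr (fun i : 'I_g => csc2_coef B x i *
  ((-1) ^+ (g - i) * 2 / (2 * (g - i)).+2`!%:R))); first by move/addrI.
by move=> i _; rewrite IH // (leq_trans (ltn_ord i)).
Qed.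

(** * Taylor bounds for [cos] and [sin] *)

Section Taylor.
Context (R : realType).
Implicit Types (f df : R -> R) (x : R).

Lemma mean_value_bound f df (n : nat) :
  (forall x, is_derive x 1 f (df x)) -> f 0 = 0 ->
  (forall x, `|df x| <= `|x| ^+ n) ->
  forall x, `|f x| <= `|x| ^+ n.+1.
Proof.
move=> fd f0 dfn x.
have fc (a b : R) : {within `[a, b], continuous f}.
  by apply: derivable_within_continuous => y _; exact: ex_derive.
have [x0|x0] := leP 0 x.
  have [c] := MVT_segment x0 (fun y _ => fd y) (@fc _ _).
  rewrite f0 !subr0 in_itv/= => /andP[c0 cx] ->.
  rewrite normrM exprSr ler_wpM2r // (le_trans (dfn c)) //.
  by rewrite lerXn2r ?nnegrE // !ger0_norm // (le_trans c0).
have [c] := MVT_segment (ltW x0) (fun y _ => fd y) (@fc _ _).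
rewrite f0 !sub0r in_itv/= => /andP[xc c0] /(congr1 Num.norm).
rewrite normrN normrM normrN exprSr => ->.
rewrite ler_wpM2r // (le_trans (dfn c)) //.
by rewrite lerXn2r ?nnegrE // !ler0_norm // ?lerN2 // ltW.
Qed.

Definition cos_poly (n : nat) : {poly R} :=
  \sum_(j < n) ((-1) ^+ j / (2 * j)`!%:R) *: 'X^(2 * j).

Definition sin_poly (n : nat) : {poly R} :=
  \sum_(j < n) ((-1) ^+ j / (2 * j).+1`!%:R) *: 'X^((2 * j).+1).

Lemma deriv_sin_poly n : (sin_poly n)^`() = cos_poly n.
Proof.
rewrite raddf_sum; apply: eq_bigr => i _ /=.
rewrite derivZ derivXn -[X in _ *: X]scaler_nat scalerA factS natrM /=; congr (_ *: _).
by field; rewrite -!natrM nat1r !pnatr_eq0 -lt0n fact_gt0.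
Qed.

Lemma deriv_cos_poly n : (cos_poly n.+1)^`() = - sin_poly n.
Proof.
rewrite raddf_sum /= big_ord_recl /= muln0 expr0 derivZ derivC scaler0 add0r.
rewrite -sumrN; apply: eq_bigr => i _; rewrite /bump /= add1n.
rewrite mulnS derivZ derivXn -[X in _ *: X]scaler_nat scalerA (factS (2 * i).+1) natrM exprS.
rewrite -scaleNr; congr (_ *: _).
by field; rewrite -!natrM -!natrD !pnatr_eq0 -lt0n fact_gt0.
Qed.

Lemma is_derive_horner (p : {poly R}) x : is_derive x 1 (horner p) p^`().[x].
Proof. by rewrite derivE derive1E; apply: DeriveDef => //; exact: derivable_horner. Qed.

(** Starting from [|cos| <= 1], the mean value bound passes from [cos] to [sin] at the same [n],
    then from [sin] to [cos] at [n + 1], gaining one power of [|x|] each time. *)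
Lemma cos_sin_taylor n x :
  `|cos x - (cos_poly n).[x]| <= `|x| ^+ (2 * n) /\
  `|sin x - (sin_poly n).[x]| <= `|x| ^+ (2 * n).+1.
Proof.
have cs m : (forall x, `|cos x - (cos_poly m).[x]| <= `|x| ^+ (2 * m)) ->
    forall x, `|sin x - (sin_poly m).[x]| <= `|x| ^+ (2 * m).+1.
  move=> h; apply: mean_value_bound h => [y|].
    by rewrite -deriv_sin_poly; apply: is_deriveB; exact: is_derive_horner.
  rewrite sin0 sub0r /sin_poly horner_sum big1 ?oppr0// => i _.
  by rewrite hornerZ hornerXn expr0n mulr0.
have h m y : `|cos y - (cos_poly m).[y]| <= `|y| ^+ (2 * m).
  elim: m y => [|m IH] y.
    by rewrite /cos_poly big_ord0 horner0 subr0 expr0 cos_max.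
  rewrite mulnS; 
  apply: (mean_value_bound (f := fun y => cos y - (cos_poly m.+1).[y])
    (df := fun y => - sin y + (sin_poly m).[y])) => [z||z].
  - rewrite -[(sin_poly m).[z]]opprK -hornerN -deriv_cos_poly.
    by apply: is_deriveB; exact: is_derive_horner.
  - rewrite cos0 /cos_poly horner_sum big_ord_recl big1 ?addr0 => [|i _].
      by rewrite hornerZ hornerXn muln0 fact0 !expr0 divr1 mulr1 subrr.
    by rewrite hornerZ hornerXn expr0n mulr0.
  by rewrite -normrN opprD opprK cs.
by split; [exact: h|exact: cs (h n) x].
Qed.

End Taylor.

(** * Asymptotic expansion of [cos (a x) / (2 sin (x / 2)) ^ 2] *)

Section CscAsymptotics.
Context (R : realType).

Lemma horner_bound (p : {poly R}) (z : R) : `|z| <= 1 ->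
  `|p.[z]| <= \sum_(i < size p) `|p`_i|.
Proof.
move=> z1; rewrite horner_coef (le_trans (ler_norm_sum _ _ _)) //.
by apply: ler_sum => i _; rewrite normrM normrX ler_piMr // exprn_ile1.
Qed.

Lemma cvg0_quadratic (K : R) (f : R -> R) :
  (forall x, x != 0 -> `|x| <= 2^-1 -> `|f x| <= K * x ^+ 2) ->
  f @ (0 : R)^' --> (0 : R).
Proof.
move=> fK; apply/cvgrPdist_le => e e0; near=> x.
have x2 : `|x| <= 2^-1 by near: x; apply: dnbhs0_le; rewrite invr_gt0.
have xe : `|x| <= e / (`|K| + 1).
  by near: x; apply: dnbhs0_le; rewrite divr_gt0 // ltr_wpDl.
rewrite sub0r normrN (le_trans (fK x _ x2)) //.
  by near: x; exact: nbhs_dnbhs_neq.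
rewrite -(real_normK (num_real x)) expr2 mulrA.
have K1 : `|K| * `|x| <= e.
  rewrite (le_trans _ (_ : (`|K| + 1) * (e / (`|K| + 1)) <= e)) //.
    by rewrite ler_pM // lerDl.
  by rewrite mulrCA divff ?mulr1 // gt_eqF // ltr_wpDl.
rewrite (le_trans (_ : _ <= `|K| * `|x| * `|x|)) //.
  by rewrite !ler_wpM2r // ler_norm.
rewrite -[leRHS]mulr1 ler_pM ?mulr_ge0 // (le_trans x2) //.
by rewrite invf_le1 // ler1n.
Unshelve. all: by end_near.
Qed.

Lemma four_sin_half_sqr (x : R) : (2 * sin (x / 2)) ^+ 2 = 2 - 2 * cos x.
Proof.
rewrite {2}[x]splitr cosD -!expr2 exprMn.
by rewrite cos2sin2; ring.
Qed.

(** Keeps the denominator away from 0: the second Taylor bound gives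
    [2 - 2 cos x >= x ^ 2 - 2 x ^ 4], and [x ^ 2 <= 1 / 4]. *)
Lemma four_sin_half_sqr_ge (x : R) : `|x| <= 2^-1 ->
  x ^+ 2 / 2 <= (2 * sin (x / 2)) ^+ 2.
Proof.
move=> x2; rewrite four_sin_half_sqr.
have [] := cos_sin_taylor 2 x; rewrite /cos_poly !big_ord_recl big_ord0 => h _.
move: h; rewrite !hornerE /= !(muln0, muln1, expr0, fact0, expr1, hornerXn) /= => h.
have : `|x| ^+ 2 <= 4^-1.
  by rewrite (le_trans (_ : _ <= 2^-1 ^+ 2)) ?lerXn2r ?nnegrE //; lra.
move: h; rewrite (exprM `|x| 2 2) real_normK ?num_real // => /ler_normlP[_].
set c := cos x; set y := x ^+ 2; have : 0 <= y by exact: sqr_ge0.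
rewrite /bump /= (_ : 2`! = 2%N) //.
have -> : 1^-1 + -1 / 2 * x * x + 0 = 1 - y / 2 :> R by rewrite /y; field.
move=> y0 h y4; have : y ^+ 2 <= y / 4 by rewrite expr2 ler_wpM2l.
by lra.
Qed.

Lemma cos_csc2_asymptotic (a : R) (c : nat -> R) :
  (forall m, \sum_(g < m.+1)
      c g * ((-1) ^+ (m - g) * 2 / (2 * (m - g)).+2`!%:R) =
    (-1) ^+ m * a ^+ (2 * m) / (2 * m)`!%:R) ->
  asymptotic_expansion (fun x => cos (a * x) / (2 * sin (x / 2)) ^+ 2) c.
Proof.
move=> c_rec N; set M := N.+1.
(* In the variable [z = x ^ 2], these are truncations of [cos (a x)], of [(2 - 2 cos x) / x ^ 2] and
   of [x ^ 2] times the claimed expansion. The recurrence says exactly that [C] and [p * T] agree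
   modulo ['X^M]. *)
pose C : {poly R} := \poly_(j < M) ((-1) ^+ j * a ^+ (2 * j) / (2 * j)`!%:R).
pose T : {poly R} := \poly_(j < M) ((-1) ^+ j * 2 / (2 * j).+2`!%:R).
pose p : {poly R} := \poly_(g < M) c g.
have /dvdpP [r rE] : 'X^M %| C - p * T.
  apply/dvdXnP => i iM; rewrite coefB coef_poly iM -c_rec coefM.
  apply/eqP; rewrite subr_eq0; apply/eqP/eq_bigr => j _; rewrite !coef_poly (leq_ltn_trans (leq_subr _ _)) //.
  by rewrite (leq_trans (ltn_ord j)).
have CE x : (cos_poly R M).[a * x] = C.[x ^+ 2].
  rewrite horner_poly horner_sum; apply: eq_bigr => j _.
  by rewrite hornerZ hornerXn exprMn -exprM; ring.
have TE x : 2 - 2 * (cos_poly R M.+1).[x] = x ^+ 2 * T.[x ^+ 2].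
  rewrite horner_poly horner_sum big_ord_recl mulrDr !mulr_sumr.
  rewrite hornerZ hornerXn muln0 !expr0 fact0 divr1 !mulr1 opprD addrA subrr.
  rewrite add0r -sumrN; apply: eq_bigr => j _.
  rewrite lift0 (_ : 2 * j.+1 = (2 * j).+2)%N; last by rewrite mulnS.
  rewrite hornerZ hornerXn -exprM !exprS.
  by ring.
pose bd (q : {poly R}) := \sum_(i < size q) `|q`_i|.
(* The three summands bound the remainder [r], the Taylor error of [cos (a x)], and the Taylor error
   of [cos x] multiplied by [p]. The factor 2 in front of [K] comes from [S >= z / 2]. *)
pose K := bd r + `|a| ^+ (2 * M) + 2 * bd p.
apply: (@cvg0_quadratic (2 * K)) => x x0 x2.
set S := (2 * sin (x / 2)) ^+ 2; pose z := x ^+ 2.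
have Sz : z / 2 <= S by exact: four_sin_half_sqr_ge.
have z0 : 0 < z by rewrite exprn_even_gt0.
have S0 : 0 < S by rewrite (lt_le_trans _ Sz) // divr_gt0.
have z1 : `|z| <= 1.
  by rewrite normrX exprn_ile1 // (le_trans x2) // invf_le1 // ler1n.
have -> : \sum_(g < M) x ^ (2 * g%:Z - 2) * c g = p.[z] / z.
  rewrite horner_poly mulr_suml; apply: eq_bigr => g _.
  rewrite expfzDr // mulrC -mulrA; congr (_ * (_ * _)).
  by rewrite -exprM -exprnP.
(* [cos x] is expanded one order further than [cos (a x)]: over the common denominator [S * z] the
   error [e1] gains a factor [z] and [e2] does not, so both end at order [z ^ M.+1]. *)
have [+ _] := cos_sin_taylor M (a * x); have [+ _] := cos_sin_taylor M.+1 x.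
set e2 := cos x - _; set e1 := cos (a * x) - _ => e2le e1le.
have -> : cos (a * x) / S - p.[z] / z = (z * (z ^+ M * r.[z] + e1) + 2 * e2 * p.[z]) / (S * z).
  have : C.[z] - p.[z] * T.[z] = r.[z] * z ^+ M.
    by rewrite -hornerXn -!hornerM -hornerN -hornerD rE.
  have := TE x; rewrite -/z => {}TE {}rE.
  have SE : S = z * T.[z] - 2 * e2.
    by rewrite /S four_sin_half_sqr -TE /e2; ring.
  have -> : cos (a * x) = e1 + C.[z] by rewrite /e1 CE -/z; ring.
  have z_neq0 : z != 0 by rewrite gt_eqF.
  have S_neq0 : S != 0 by rewrite gt_eqF.
  rewrite (_ : C.[z] = r.[z] * z ^+ M + p.[z] * T.[z]); last by rewrite -rE subrK.
  rewrite (_ : _ + 2 * e2 * p.[z] =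
    z * (e1 + (r.[z] * z ^+ M + p.[z] * T.[z])) - S * p.[z]).
    by field; rewrite z_neq0 S_neq0.
  by rewrite SE; ring.
have {}e1le : `|e1| <= `|a| ^+ (2 * M) * z ^+ M.
  by rewrite (le_trans e1le) // normrM exprMn (exprM `|x|) real_normK ?num_real.
have {}e2le : `|e2| <= z ^+ M.+1.
  by rewrite (le_trans e2le) // exprM real_normK ?num_real.
have zN n : 0 < z ^+ n by rewrite exprn_gt0.
have bd0 q : 0 <= bd q by apply: sumr_ge0.
have K0 : 0 <= K by rewrite !addr_ge0 ?mulr_ge0 ?exprn_ge0.
have rp := horner_bound r z1; have pp := horner_bound p z1.
have num_le : `|z * (z ^+ M * r.[z] + e1) + 2 * e2 * p.[z]| <= K * z ^+ M.+1.
  have -> : K * z ^+ M.+1 = z * (z ^+ M * bd r + `|a| ^+ (2 * M) * z ^+ M)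
      + 2 * z ^+ M.+1 * bd p by rewrite /K exprS; ring.
  rewrite (le_trans (ler_normD _ _)) // lerD //.
    rewrite normrM (gtr0_norm z0) ler_pM2l // (le_trans (ler_normD _ _)) //.
    by rewrite lerD // normrM (gtr0_norm (zN M)) ler_pM2l.
  by rewrite !normrM normr_nat ler_pM ?mulr_ge0 ?ler_pM2l.
have -> : x ^ (2 * N%:Z - 2) = z ^+ N / z.
  by rewrite expfzDr // -exprM -exprnP.
have -> : 2 * K * x ^+ 2 = 2 * K * z by [].
have den0 : 0 < S * z * (z ^+ N / z) by do 2 ?apply: mulr_gt0; rewrite ?invr_gt0.
rewrite -mulrA -invfM normrM normfV (gtr0_norm den0) ler_pdivrMr //.
rewrite (le_trans num_le) //.
rewrite (_ : 2 * K * z * _ = K * z ^+ M * (2 * S)); last first.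
  by rewrite /M exprS; field; rewrite gt_eqF.
rewrite exprSr mulrA; apply: ler_wpM2l; first by rewrite mulr_ge0 // ltW.
by move: Sz; lra.
Qed.

End CscAsymptotics.

(** * Uniqueness, rescaling and sums of asymptotic expansions *)

Section AsymptoticExpansion.
Context (R : realType).
Implicit Types (f : R -> R) (a b : nat -> R).

Lemma near_cvg0 (f g : R -> R) : {near (0 : R)^', f =1 g} ->
  f @ (0 : R)^' --> (0 : R) -> g @ (0 : R)^' --> (0 : R).
Proof.
move=> fg; apply: cvg_trans; apply: near_eq_cvg.
by apply: filterS fg => x ->.
Qed.

Lemma near_asymptotic (f g : R -> R) a : {near (0 : R)^', f =1 g} ->
  asymptotic_expansion f a -> asymptotic_expansion g a.
Proof.
by move=> fg fa N; apply: near_cvg0 (fa N); apply: filterS fg => x ->.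
Qed.

Lemma asymptotic_uniq f a b :
  asymptotic_expansion f a -> asymptotic_expansion f b -> a =1 b.
Proof.
move=> fa fb N; have [M] := ubnP N; elim: M N => // M IH N NM.
apply/eqP; rewrite -subr_eq0; apply/eqP.
(* Once the earlier coefficients agree, the difference of the two order [N] quotients is the
   constant [a N - b N] off 0, and it tends to 0. *)
have ab : (fun=> a N - b N) x @[x --> (0 : R)^'] --> (0 : R).
  have := cvgB (fb N) (fa N); rewrite subr0 => h; apply: near_cvg0 (h _).
  near=> x.
  have x0 : x != 0 by near: x; exact: nbhs_dnbhs_neq.
  rewrite !fctE -mulrBl opprB addrC addrA subrK -sumrB.
  rewrite big_ord_recr big1 => [/=|i _]; last first.
    by rewrite IH ?subrr // (leq_trans (ltn_ord i)).
  by rewrite add0r -mulrBr mulrAC divff ?mul1r // expfz_neq0.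
exact: (cvg_unique (@norm_hausdorff _ R) (cvg_cst (a N - b N)) ab).
Unshelve. all: by end_near.
Qed.

Lemma asymptotic_scale (c k : R) f a : k != 0 ->
  asymptotic_expansion f a ->
  asymptotic_expansion (fun x => c * f (k * x))
    (fun g => c * k ^ (2 * g%:Z - 2) * a g).
Proof.
move=> k0 fa N.
(* Injectivity of multiplication by [k] keeps the limit inside the punctured neighbourhood. *)
have k_cvg : k * x @[x --> (0 : R)^'] --> (0 : R)^'.
  rewrite -[X in _ --> dnbhs X](mulr0 k); apply: continuous_injective_withinNx.
    exact: mulrl_continuous.
  by move=> y /(mulfI k0).
have := cvgM (cvg_cst (c * k ^ (2 * N%:Z - 2))) (cvg_comp _ _ k_cvg (fa N)).
rewrite mulr0 => h; apply: near_cvg0 (h _ _); near=> x.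
have x0 : x != 0 by near: x; exact: nbhs_dnbhs_neq.
rewrite !fctE /= [(k * x) ^ (2 * N%:Z - 2)]expfzMl invfM.
rewrite (_ : \sum_(g < N.+1) (k * x) ^ (2 * g%:Z - 2) * a g =
  \sum_(g < N.+1) k ^ (2 * g%:Z - 2) * a g * x ^ (2 * g%:Z - 2)); last first.
  by apply: eq_bigr => i _; rewrite expfzMl mulrAC.
rewrite (_ : \sum_(g < N.+1) x ^ (2 * g%:Z - 2) * _ =
  c * \sum_(g < N.+1) k ^ (2 * g%:Z - 2) * a g * x ^ (2 * g%:Z - 2)); last first.
  by rewrite mulr_sumr; apply: eq_bigr => i _; ring.
rewrite -mulrBr -[LHS]mulrA [LHS]mulrC; set K := k ^ _.
have K0 : K != 0 by rewrite expfz_neq0.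
by field; rewrite K0 expfz_neq0.
Unshelve. all: by end_near.
Qed.

Lemma asymptotic_sum (I : eqType) (r : seq I) (f : I -> R -> R)
    (a : I -> nat -> R) :
  (forall i, i \in r -> asymptotic_expansion (f i) (a i)) ->
  asymptotic_expansion (fun x => \sum_(i <- r) f i x)
    (fun g => \sum_(i <- r) a i g).
Proof.
elim: r => [_ N|i r IH fa N].
  apply: near_cvg0 (cvg_cst (0 : R)); apply: nearW => x.
  by rewrite big_nil big1 ?subr0 ?mul0r // => j _; rewrite big_nil mulr0.
have far j : j \in r -> asymptotic_expansion (f j) (a j).
  by move=> jr; apply: fa; rewrite inE jr orbT.
have := cvgD (fa i (mem_head _ _) N) (IH far N).
rewrite addr0 => h; apply: near_cvg0 (h _).
apply: nearW => x /=; rewrite !fctE -mulrDl; congr (_ / _).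
rewrite big_cons addrACA -opprD -big_split; congr (_ - _).
by apply: eq_bigr => j _; rewrite big_cons mulrDr.
Qed.

(** Limits pass through the sum over [A] because one finite set [A0], independent of [x] and [g],
    contains every support. *)
Lemma asymptotic_fsum (I : choiceType) (A A0 : set I)
    (f : I -> R -> R) (a : I -> nat -> R) :
  finite_set A0 -> A0 `<=` A ->
  (forall i, A i -> ~ A0 i -> (forall x, f i x = 0) /\ (forall g, a i g = 0)) ->
  (forall i, A0 i -> asymptotic_expansion (f i) (a i)) ->
  asymptotic_expansion (fun x => \sum_(i \in A) f i x)
    (fun g => \sum_(i \in A) a i g).
Proof.
move=> A0fin A0A out fa.
have -> : (fun x => \sum_(i \in A) f i x) =
    (fun x => \sum_(i <- fset_set A0) f i x).
  apply/funext => x; rewrite -fsbig_finite //; apply/esym/fsbig_widen => //.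
  by move=> i [Ai /(out i Ai)[h _]]; exact: h.
have -> : (fun g => \sum_(i \in A) a i g) =
    (fun g => \sum_(i <- fset_set A0) a i g).
  apply/funext => x; rewrite -fsbig_finite //; apply/esym/fsbig_widen => //.
  by move=> i [Ai /(out i Ai)[_ h]]; exact: h.
by apply: asymptotic_sum => i; rewrite in_fset_set // => /set_mem; exact: fa.
Qed.

End AsymptoticExpansion.

(** * Truncation of sums, and the unit circle [e ^ (i a)] *)

Lemma fsum_nat_trunc (V : nmodType) (N : nat) (F : nat -> V) :
  (forall g, (N <= g)%N -> F g = 0) ->
  \sum_(g \in [set: nat]) F g = \sum_(g < N) F g.
Proof.
move=> F0; rewrite fsbig_ord; apply/esym/fsbig_widen => // g [_ /= /negP].
by rewrite -leqNgt => /F0.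
Qed.

Section Cis.
Context (R : realType).
Implicit Types (a b : R).

Definition cis a : R[i] := (cos a +i* sin a)%C.

Lemma cisD a b : cis (a + b) = cis a * cis b.
Proof. by rewrite /cis cosD sinD; simpc; congr (_ +i* _)%C; ring. Qed.

Lemma cis_neq0 a : cis a != 0.
Proof.
apply/eqP => /(congr1 ( *%R^~ (cis (- a)))); rewrite -cisD subrr mul0r /cis.
by rewrite cos0 => -[] /eqP; rewrite oner_eq0.
Qed.

Lemma cisN a : cis (- a) = (cis a)^-1.
Proof.
apply: (mulfI (cis_neq0 a)); rewrite -cisD subrr divff ?cis_neq0//.
by rewrite /cis cos0 sin0.
Qed.

Lemma cis_nat a n : cis a ^+ n = cis (n%:R * a).
Proof.
elim: n => [|n IH]; first by rewrite mul0r /cis cos0 sin0.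
by rewrite exprS IH -cisD -nat1r mulrDl mul1r.
Qed.

Lemma cis_int a (n : int) : cis a ^ n = cis (n%:~R * a).
Proof.
case: n => n; first exact: cis_nat.
by rewrite NegzE -invr_expz -exprnP cis_nat -cisN mulrNz mulNr.
Qed.

Lemma Re_sum (I : Type) (r : seq I) (F : I -> R[i]) :
  complex.Re (\sum_(i <- r) F i) = \sum_(i <- r) complex.Re (F i).
Proof. by apply: (big_morph (@complex.Re R)) => // -[a b] [c d]. Qed.

Lemma Re_intM (k : int) (w : R[i]) :
  complex.Re (k%:~R * w) = k%:~R * complex.Re w.
Proof.
rewrite -(rmorph_int (real_complex R)); case: w => a b /=.
by rewrite mul0r subr0.
Qed.

End Cis.

(** * The sheaf invariants identity evaluated on the unit circle *)

Section Sheaf.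
Context (GV : nat -> int) (Omega : int -> int) (G : nat).
Context (GV0 : forall g, (G <= g)%N -> GV g = 0).
Context (Omega_fin : finite_set [set n | Omega n != 0]).

Let supp := fset_set [set n | Omega n != 0].
(** Large enough that every exponent [n + N] on the support, and every [N - g] with [g < N], is
    nonnegative. *)
Let N : nat := G + \max_(n <- supp) absz n.

(* Multiplied by [('X ^+ 2) ^+ N], the difference of the two sides of the
   defining identity of the sheaf invariants becomes a polynomial. *)
Let cleared : {poly int} :=
  \sum_(n <- supp) (Omega n)%:~R * ('X ^+ 2) ^+ absz (n + N%:Z)
  - \sum_(g < N) (GV g)%:~R * (-1) ^+ g * (('X ^+ 2 - 1) ^+ 2) ^+ g *
      ('X ^+ 2) ^+ (N - g).

Let fsum_supp (K : pzRingType) (F : int -> K) :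
  \sum_(n \in [set: int]) (Omega n)%:~R * F n =
  \sum_(n <- supp) (Omega n)%:~R * F n.
Proof.
apply: fsbigTE => n /negP nO.
have [->|On] := eqVneq (Omega n) 0; first by rewrite mul0r.
by case: nO; rewrite in_fset_set //; exact: mem_set.
Qed.

(** Stated for any morphism in order to serve twice: at the injective [tofrac], to deduce
    [cleared = 0], and then at evaluation in a complex number. *)
Let clearedE (K : fieldType) (phi : {rmorphism {poly int} -> K}) :
  phi 'X != 0 ->
  (\sum_(n \in [set: int]) (Omega n)%:~R * (phi 'X ^+ 2) ^ n
   - \sum_(g \in [set: nat])
       (GV g)%:~R * (-1) ^+ g * (phi 'X - (phi 'X)^-1) ^+ (2 * g))
  * (phi 'X ^+ 2) ^+ N = phi cleared.
Proof.
set u := phi 'X => u0; have u20 : u ^+ 2 != 0 by rewrite expf_neq0.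
rewrite fsum_supp.
rewrite (fsum_nat_trunc (N := N)) => [|g Ng]; last first.
  by rewrite GV0 ?mul0r // (leq_trans (leq_addr _ _) Ng).
rewrite mulrBl !mulr_suml rmorphB !rmorph_sum /=; congr (_ - _).
  rewrite !big_seq; apply: eq_bigr => n nS.
  rewrite rmorphM rmorph_int !rmorphXn -mulrA; congr (_ * _).
  have nN : 0 <= n + N%:Z.
    have : (absz n <= N)%N by rewrite (leq_trans _ (leq_addl _ _)) ?leq_bigmax_seq.
    by lia.
  by rewrite [RHS]exprnP gez0_abs // expfzDr.
apply: eq_bigr => -[g /= gN] _.
rewrite !rmorphM rmorph_int !rmorphXn rmorphN1 rmorphB rmorph1 rmorphXn -!mulrA.
congr (_ * (_ * _)).
rewrite -[X in _ * (u ^+ 2) ^+ X = _](subnKC (ltnW gN)) -/u.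
rewrite [(u ^+ 2) ^+ _]exprD mulrA exprM -exprMn.
congr (_ ^+ _ * _); field.
exact: u0.
Qed.

(** Substitute [e ^ (i x / 2)] for [y ^ (1 / 2)] and take real parts;
    [(z - z^-1) ^ 2 = - (2 sin (x / 2)) ^ 2] absorbs the sign [(-1) ^ g]. *)
Lemma sheaf_cos (R : realType) (x : R) :
  \sum_(n \in [set: int]) (Omega n)%:~R * (sqrty ^+ 2) ^ n =
  \sum_(g \in [set: nat])
      (GV g)%:~R * (-1) ^+ g * (sqrty - sqrty^-1) ^+ (2 * g) ->
  \sum_(n \in [set: int]) (Omega n)%:~R * cos (n%:~R * x) =
  \sum_(g \in [set: nat]) (GV g)%:~R * (2 * sin (x / 2)) ^+ (2 * g).
Proof.
move=> sheaf.
have cleared0 : cleared = 0.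
  have X0 : tofrac ('X : {poly int}) != 0 by rewrite tofrac_eq0 polyX_eq0.
  have := clearedE (phi := @tofrac {poly int}) X0; rewrite -/sqrty sheaf subrr mul0r.
  by move/eqP; rewrite eq_sym tofrac_eq0 => /eqP.
set z := cis (x / 2).
have zc : commr_rmorph (intr : int -> R[i]) z by move=> k; exact: mulrC.
pose phi : {rmorphism {poly int} -> R[i]} := horner_morph zc.
have phiX : phi 'X = z by exact: horner_morphX.
have := clearedE (phi := phi); rewrite phiX cis_neq0.
move=> /(_ isT); rewrite cleared0 rmorph0 => /eqP; rewrite mulf_eq0.
rewrite [X in _ || X]negbTE ?expf_neq0 ?cis_neq0 // orbF subr_eq0 => /eqP.
move=> /(congr1 (@complex.Re R)).
rewrite fsum_supp (fsum_nat_trunc (N := G)) => [|g Gg]; last by rewrite GV0 ?mul0r.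
rewrite !Re_sum => eqRe.
rewrite fsum_supp (fsum_nat_trunc (N := G)) => [|g Gg]; last by rewrite GV0 ?mul0r.
transitivity (\sum_(n <- supp) complex.Re ((Omega n)%:~R * (z ^+ 2) ^ n)).
  apply: eq_bigr => n _; rewrite Re_intM cis_nat cis_int.
  by congr (_ * cos (_ * _)); field.
rewrite eqRe; apply: eq_bigr => g _.
rewrite -mulrA Re_intM; congr (_ * _).
have z2 : (z - z^-1) ^+ 2 = (- (2 * sin (x / 2)) ^+ 2)%:C%C.
  rewrite -cisN /z /cis cosN sinN; simpc; congr (_ +i* _)%C; ring.
have z2N : -1 * (z - z^-1) ^+ 2 = ((2 * sin (x / 2)) ^+ 2)%:C%C.
  by rewrite z2 rmorphN mulrNN mul1r.
by rewrite [in LHS]exprM -exprMn z2N -rmorphXn -exprM.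
Qed.
End Sheaf.

(** * Additive maps and sums of finite support *)

Lemma fsum_morph (U V : nmodType) (phi : U -> V) (I : choiceType) (A : set I)
    (F : I -> U) :
  phi 0 = 0 -> {morph phi : u v / u + v} -> (forall u, phi u = 0 -> u = 0) ->
  phi (\sum_(i \in A) F i) = \sum_(i \in A) phi (F i).
Proof.
move=> phi0 phiD phi_inj.
(* A trivial kernel makes the two supports equal, so that both sums are genuine or both take the
   default value 0. *)
have suppE : A `&` (phi \o F) @^-1` [set~ 0] = A `&` F @^-1` [set~ 0].
  apply/seteqP; split=> i [Ai /= Fi]; split=> // Fi0; apply: Fi.
    by rewrite /= Fi0.
  exact: phi_inj.
have [Ffin|Finf] := pselect (finite_set (A `&` F @^-1` [set~ 0])).
  rewrite fsbig_supp [RHS]fsbig_supp suppE !fsbig_finite //.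
  exact: big_morph.
by rewrite !fsbig_dflt // suppE.
Qed.

Lemma fsum_mull (K : fieldType) (c : K) (I : choiceType) (A : set I)
    (F : I -> K) :
  c * \sum_(i \in A) F i = \sum_(i \in A) c * F i.
Proof.
have [->|c0] := eqVneq c 0; first by rewrite mul0r fsbig1 // => i _; rewrite mul0r.
apply: fsum_morph => [|u v|u /eqP]; rewrite ?mulr0 ?mulrDr // mulf_eq0.
by rewrite (negbTE c0) => /eqP.
Qed.

Lemma ratr_fsum (K : numFieldType) (I : choiceType) (A : set I) (f : I -> rat) :
  ratr (\sum_(i \in A) f i) = \sum_(i \in A) (ratr (f i) : K).
Proof.
apply: (fsum_morph (phi := ratr : rat -> K)) => [|u v|u /eqP];
  rewrite ?rmorph0 ?rmorphD // fmorph_eq0.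
by move=> /eqP.
Qed.

(** * Contribution of a single curve class *)

Section OneClass.
Context (R : realType) (B : nat -> {poly rat}) (B_gen : bernoulli_polynomials B).
Context (GV : nat -> int) (Omega : int -> int) (G : nat).
Context (GV0 : forall g, (G <= g)%N -> GV g = 0).
Context (Omega_fin : finite_set [set n | Omega n != 0]).
Context (sheaf :
  \sum_(n \in [set: int]) (Omega n)%:~R * (sqrty ^+ 2) ^ n =
  \sum_(g \in [set: nat])
      (GV g)%:~R * (-1) ^+ g * (sqrty - sqrty^-1) ^+ (2 * g)).

(** The coefficient of [lambda ^ (2 g - 2)] in the [k = 1] term of one class in [F_GV]. *)
Definition sheaf_coef (g : nat) : rat :=
  \sum_(n \in [set: int]) (Omega n)%:~R * csc2_coef B n%:~R g.

Lemma cos_csc2_bernoulli (n : int) :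
  asymptotic_expansion
    (fun x : R => cos (n%:~R * x) / (2 * sin (x / 2)) ^+ 2)
    (fun g => ratr (csc2_coef B n%:~R g)).
Proof.
apply: cos_csc2_asymptotic => m.
have /(congr1 (ratr : rat -> R)) := csc2_coef_conv B_gen n%:~R m.
rewrite rmorph_sum !rmorphM /= !rmorphXn rmorphN1 fmorphV rmorph_nat rmorph_int => <-.
apply: eq_bigr => i _.
rewrite [RHS]rmorphM; congr (_ * _).
by rewrite !rmorphM /= rmorphXn rmorphN1 fmorphV !rmorph_nat.
Qed.

Lemma sheaf_asymptotic :
  asymptotic_expansion
    (fun x : R => \sum_(g \in [set: nat])
       (GV g)%:~R * (2 * sin (x / 2)) ^ (2 * g%:Z - 2))
    (fun g => ratr (sheaf_coef g)).
Proof.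
have -> : (fun g => ratr (sheaf_coef g) : R) = fun g =>
    \sum_(n \in [set: int]) (Omega n)%:~R * (ratr (csc2_coef B n%:~R g) : R).
  apply/funext => g; rewrite ratr_fsum; apply: eq_fsbigr => n _.
  by rewrite rmorphM rmorph_int.
apply: (@near_asymptotic _ (fun x => \sum_(n \in [set: int])
    (Omega n)%:~R * (cos (n%:~R * x) / (2 * sin (x / 2)) ^+ 2))).
  near=> x.
  have x0 : x != 0 by near: x; exact: nbhs_dnbhs_neq.
  have x2 : `|x| <= 2^-1 by near: x; apply: dnbhs0_le; rewrite invr_gt0.
  have s0 : 2 * sin (x / 2) != 0.
    rewrite -sqrf_eq0 gt_eqF // (lt_le_trans _ (four_sin_half_sqr_ge x2)) //.
    by rewrite divr_gt0 // exprn_even_gt0.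
  transitivity ((2 * sin (x / 2)) ^- 2 * \sum_(n \in [set: int])
      (Omega n)%:~R * cos (n%:~R * x)).
    by rewrite fsum_mull; apply: eq_fsbigr => n _; ring.
  (* Dividing [sheaf_cos] by [(2 sin (x / 2)) ^ 2], nonzero near 0, lowers the exponent [2 g] to
     [2 g - 2]. *)
  rewrite (sheaf_cos GV0 Omega_fin x sheaf) fsum_mull; apply: eq_fsbigr => g _.
  by rewrite expfzDr // mulrCA; congr (_ * _); rewrite mulrC.
apply: (asymptotic_fsum Omega_fin) => // [n _ /negP|n _].
  by rewrite negbK => /eqP ->; split=> x; rewrite mul0r.
have := asymptotic_scale (Omega n)%:~R (oner_neq0 R) (cos_csc2_bernoulli n).
congr asymptotic_expansion; apply/funext => x; first by rewrite mul1r.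
by rewrite exp1rz mulr1.
Unshelve. all: by end_near.
Qed.

End OneClass.

(** * Summation over classes and multiple covers *)

Section Assembly.
Context (R : realType) (H2 : zmodType) (curve : set H2).
Context (curve_fin : finitely_divisible curve).
Context (GW : H2 -> nat -> rat) (GV : H2 -> nat -> int).
Context (GV_fin : eventually_zero_GV curve GV).
Context (GW_GV : GV_invariants R curve GW GV).
Context (Omega : H2 -> int -> int) (Omega_GV : sheaf_invariants curve GV Omega).
Context (B : nat -> {poly rat}) (B_gen : bernoulli_polynomials B).

Lemma finite_multiplicities (beta gamma : H2) : curve beta ->
  finite_set [set k | posnat k /\ beta *+ k = gamma].
Proof.
move=> cb; apply: sub_finite_set (finite_image fst (curve_fin gamma)).
by move=> k [k0 kb]; exists (k, beta).
Qed.

(** For fixed [gamma] only the finitely many pairs [(k, beta)] with [k beta = gamma] matter. The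
    [k]-fold cover is the [k = 1] series at [k lambda], weighted by [1 / k]; the resulting
    [k ^ (2 g - 3)] produces the polylogarithm of index [3 - 2 g]. *)
Lemma asymptotic_F_GV (gamma : H2) :
  asymptotic_expansion (fun lambda : R => F_GV curve GV lambda gamma)
    (fun g => \sum_(beta \in curve)
       (ratr (polylogQ rat (3 - 2 * g%:Z) beta gamma *
              sheaf_coef B (Omega beta) g) : R)).
Proof.
apply: (asymptotic_fsum (finite_image snd (curve_fin gamma))).
- by move=> _ [[k beta] [/= _ cb _] <-].
- move=> beta cb nb.
  have Q0 (K : nzRingType) k : posnat k -> Qmon K (beta *+ k) gamma = 0.
    move=> k0; rewrite /Qmon; case: eqP => // kb.
    by case: nb; exists (k, beta).
  split=> [x|g].
    rewrite fsbig1 // => g _; rewrite fsbig1 ?mulr0 // => k k0.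
    by rewrite Q0 ?mulr0.
  by rewrite /polylogQ fsbig1 ?mul0r ?rmorph0 // => k k0; rewrite Q0 ?mul0r.
move=> _ [[k0 beta] [/= _ cb _] <-].
have [G _ GV0] := GV_fin cb.
have {}GV0 g : (G <= g)%N -> GV beta g = 0 by move=> Gg; exact: GV0.
have [Ofin sheaf] := Omega_GV cb.
set mult := [set k | posnat k /\ beta *+ k = gamma].
have mult_fin : finite_set mult by exact: finite_multiplicities.
have mult_pos : mult `<=` posnat by move=> k [].
have Q0 (K : nzRingType) k : ~ mult k -> posnat k -> Qmon K (beta *+ k) gamma = 0.
  by move=> nk kp; rewrite /Qmon; case: eqP => // kb; case: nk.
pose h (x : R) := \sum_(g \in [set: nat])
   (GV beta g)%:~R * (2 * sin (x / 2)) ^ (2 * g%:Z - 2).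
apply: (@near_asymptotic _ (fun x : R => \sum_(k \in posnat)
   (k%:R^-1 * Qmon R (beta *+ k) gamma) * h (k%:R * x))).
  (* Exchange of the sums over [g] and [k], after truncation to [g < G] and to [k] in [mult]. *)
  apply: nearW => x; rewrite /h.
  rewrite [RHS](fsum_nat_trunc (N := G)) => [|g Gg]; last by rewrite GV0 ?mul0r.
  rewrite -(fsbig_widen mult) // => [|k [kp nk]]; last first.
    by rewrite /= Q0 // mulr0 mul0r.
  rewrite fsbig_finite //.
  under [RHS]eq_bigr => g _.
    rewrite -(fsbig_widen mult) // => [|k [kp nk]]; last first.
      by rewrite /= Q0 // mulr0.
    rewrite fsbig_finite // mulr_sumr.
    over.
  rewrite exchange_big /=; apply: eq_bigr => k _.
  rewrite (fsum_nat_trunc (N := G)) => [|g Gg]; last by rewrite GV0 ?mul0r.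
  by rewrite mulr_sumr; apply: eq_bigr => g _; ring.
have -> : (fun g => ratr (polylogQ rat (3 - 2 * g%:Z) beta gamma *
              sheaf_coef B (Omega beta) g) : R) =
   fun g => \sum_(k \in posnat)
     (k%:R^-1 * Qmon R (beta *+ k) gamma) * k%:R ^ (2 * g%:Z - 2) *
     (ratr (sheaf_coef B (Omega beta) g) : R).
  apply/funext => g; rewrite rmorphM /= /polylogQ ratr_fsum mulrC fsum_mull.
  apply: eq_fsbigr => k /set_mem kp; rewrite mulrC; congr (_ * _).
  have k0' : k%:R != 0 :> R by rewrite pnatr_eq0 -lt0n.
  rewrite rmorphM fmorphV /= fmorphXz /= rmorph_nat /Qmon rmorph_nat.
  rewrite [in RHS]mulrAC [RHS]mulrC; congr (_ * _).
  rewrite invr_expz -[k%:R^-1]/(k%:R ^ (-1)) -expfzDr //; congr (_ ^ _); ring.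
apply: (asymptotic_fsum mult_fin mult_pos) => [k kp nk|k [kp kb]].
  by split=> x; rewrite Q0 // !(mulr0, mul0r).
have k0' : k%:R != 0 :> R by rewrite pnatr_eq0 -lt0n.
have h_asym := sheaf_asymptotic (R := R) B_gen GV0 Ofin sheaf.
exact: (asymptotic_scale (f := h) (k%:R^-1 * Qmon R (beta *+ k) gamma) k0' h_asym).
Qed.

(** [F_GV] now has two expansions at 0; uniqueness identifies their real coefficients, and
    injectivity of [ratr] brings the equality back to the rationals. *)
Lemma Ftilde_sheaf (g : nat) (gamma : H2) :
  Ftilde curve GW g gamma = \sum_(beta \in curve)
    polylogQ rat (3 - 2 * g%:Z) beta gamma * sheaf_coef B (Omega beta) g.
Proof.
have := asymptotic_uniq (GW_GV gamma) (asymptotic_F_GV gamma) g.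
by rewrite -ratr_fsum => /fmorph_inj.
Qed.

End Assembly.

(** * The formulas in genus 0, 1 and at least 2 *)

Lemma csc2_coef0 (B : nat -> {poly rat}) (B_gen : bernoulli_polynomials B)
    (x : rat) : csc2_coef B x 0 = 1.
Proof.
(* At [m = 0] the recurrence has one term, with weight [2 / 2! = 1], and right-hand side 1. *)
have := csc2_coef_conv B_gen x 0.
rewrite big_ord1 /= [X in _ = X -> _](_ : _ = 1); last by rewrite !mul1r invr1.
by rewrite [X in _ * X](_ : _ = 1) ?mulr1 // mul1r divff.
Qed.

Unset Implicit Arguments.
Theorem proposition5p1 (R : realType) (H2 : zmodType) (curve : set H2)
    (curve_fin : finitely_divisible curve)
    (GW : H2 -> nat -> rat) (GV : H2 -> nat -> int)
    (GV_fin : eventually_zero_GV curve GV)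
    (GW_GV : GV_invariants R curve GW GV)
    (Omega : H2 -> int -> int)
    (Omega_GV : sheaf_invariants curve GV Omega)
    (B : nat -> {poly rat}) (B_gen : bernoulli_polynomials B) :
  (forall gamma : H2,
     Ftilde curve GW 0%N gamma =
     \sum_(beta \in curve) \sum_(n \in [set: int])
       (Omega beta n)%:~R *
       \sum_(k \in posnat) Qmon rat (beta *+ k) gamma / k%:R ^+ 3)
  /\
  (* The leading minus sign corrects the source: for the resolved conifold
     (GV = 1 at g = 0, Omega = 1 at n = 0) the genus one part is
     Li_1(Q) / 12, since (2 sin (x/2))^-2 = x^-2 + 1/12 + O(x^2), while
     (2 * 0 * B_1(0) - B_2(0)) / 2 = - 1/12 *)
  (forall gamma : H2,
     Ftilde curve GW 1%N gamma =
     \sum_(beta \in curve) \sum_(n \in [set: int])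
       (Omega beta n)%:~R *
       - (2^-1 * (2 * n%:~R * (B 1%N).[n%:~R] - (B 2%N).[n%:~R])) *
       polylogQ rat 1 beta gamma)
  /\
  (forall g : nat, (2 <= g)%N -> forall gamma : H2,
     Ftilde curve GW g gamma =
     \sum_(beta \in curve) \sum_(n \in [set: int])
       ((-1) ^+ (g - 1) * (Omega beta n)%:~R / (2 * (2 * g)`!%:R)) *
       ((2 * g - 1)%:R * ((B (2 * g)%N).[n%:~R] + (B (2 * g)%N).[- n%:~R])
        - (2 * g)%:R * n%:~R *
          ((B (2 * g - 1)%N).[n%:~R] - (B (2 * g - 1)%N).[- n%:~R])) *
       polylogQ rat (3 - 2 * g%:Z) beta gamma).
Proof.
have FE := Ftilde_sheaf curve_fin GV_fin GW_GV Omega_GV B_gen.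
split; [|split] => [gamma|gamma|g g2 gamma]; rewrite FE; apply: eq_fsbigr => beta _;
  rewrite fsum_mull; apply: eq_fsbigr => n _; rewrite mulrC.
- by rewrite csc2_coef0 // mulr1.
- congr (_ * _ * _); rewrite /csc2_coef (_ : (2 * 1)%N = 2%N) //.
  by rewrite (_ : 2`! = 2%N) // (_ : (2 - 1)%N = 1%N) //; field.
congr (_ * _).
(* Averaging over [n] and [- n], allowed by evenness, gives the symmetric form of the statement; the
   factor [n] changes sign, whence the difference of the [B (2 * g - 1)] values. *)
have -> : csc2_coef B n%:~R g =
    (csc2_coef B n%:~R g + csc2_coef B (- n%:~R) g) / 2.
  by rewrite csc2_coefN //; field.
rewrite /csc2_coef.
have -> : (-1) ^+ g.+1 = (-1) ^+ (g - 1) :> rat.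
  by rewrite -[g in LHS](subnK (ltnW g2)) addn1 !exprS !mulN1r opprK.
have -> : (2 * g - 1)%:R = (2 * g)%:R - 1 :> rat.
  by rewrite natrB //; lia.
by field; rewrite pnatr_eq0 -lt0n fact_gt0.
Qed.
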